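(* Suppose problem $\mathcal{PE}$ has a non-empty feasible set, and in problem $\mathcal{MPC}$ let $W=W^\ast$ and $P=P^\ast$, where $W^\ast,P^\ast$ are maximizers of problem $\mathcal{PE}$. Let $N\ge 1$ and let $\mathcal{X}_N$ be the set of initial states for which problem $\mathcal{MPC}$ is feasible. Assume that $x_{k|k}=x_k\in\mathcal{X}_N$ and that the control applied at time $k$ is $\pi^{MPC}(x_k)=\pi^\ast_{k|k}(x_{k|k})$. Then the next state $x_{k+1|k+1}=A(w_k)x_{k|k}+B(w_k)\pi^{MPC}(x_k)$ belongs to $\mathcal{X}_N$ surely, i.e. for every realization of $w_k\in\mathcal W$.
   Context: System: $x_{k+1}=A(w_k)x_k+B(w_k)u_k$, $k\in\{0,1,2,\dots\}$, with $x_k\in\mathbb{R}^{N_x}$, $u_k\in\mathbb{R}^{N_u}$, $x_0$ deterministic. The disturbances $w_k$ are independent of each other and of the past, taking values in a finite set $\mathcal W=\{w^{[1]},\dots,w^{[L]}\}$ with time-invariant pmf $p$, $p(j)=\mathbb{P}(w_k=w^{[j]})>0$. Write $A_j=A(w^{[j]})$, $B_j=B(w^{[j]})$. Risk measure: $\mathcal U^{\mathrm{poly}}$ is a fixed (independent of time and state) non-empty polytope of pmfs, $\mathcal U^{\mathrm{poly}}=\{q\in\Delta^L : S^I q\le T^I,\ S^E q=T^E\}$, $\Delta^L=\{q\in\mathbb{R}^L: q\ge 0,\ \sum_j q(j)=1\}$; its finite set of vertices is $\mathcal U^{\mathrm{poly},V}$. For a real random variable $Z$ depending on $w_0,\dots,w_k$,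 $\rho_k(Z)$ is the function of $w_0,\dots,w_{k-1}$ given by $\rho_k(Z)=\max_{q\in\mathcal U^{\mathrm{poly}}}\sum_{j=1}^L q(j)\,Z(w_0,\dots,w_{k-1},w^{[j]})$. The Markov dynamic polytopic risk measure is $\rho_{k,M}(Z_k,\dots,Z_M)=Z_k+\rho_k(Z_{k+1}+\rho_{k+1}(Z_{k+2}+\dots+\rho_{M-1}(Z_M)\dots))$. Costs and constraints: $C(x,u)=x^\top Qx+u^\top Ru$ with $Q=Q^\top\succ0$, $R=R^\top\succ0$. $\mathbb X=\{x\in\mathbb{R}^{N_x}:\|T_xx\|_2\le x_{\max}\}$ and $\mathbb U=\{u\in\mathbb{R}^{N_u}:\|T_uu\|_2\le u_{\max}\}$ are compact convex sets, with $x_{\max},u_{\max}>0$. For $W=W^\top\succ0$, $\mathcal E_{\max}(W)=\{x\in\mathbb{R}^{N_x}: x^\top W^{-1}x\le 1\}$. Problem $\mathcal{PE}$: maximize $\log\det(W)$ over $W=W^\top\succ0$, $P=P^\top\succ0$, $F\in\mathbb{R}^{N_u\times N_x}$ subject to (a) $F^\top \frac{T_u^\top T_u}{u_{\max}^2}F-W^{-1}\preceq0$; (b) $\sum_{j=1}^L q_l(j)(A_j+B_jF)^\top P(A_j+B_jF)-P+(F^\top RF+Q)\prec0$ for all $q_l\in\mathcal U^{\mathrm{poly},V}$; and for all $j\in\{1,\dots,L\}$: (c) $(A_j+B_jF)^\top\frac{T_x^\top T_x}{x_{\max}^2}(A_j+B_jF)-W^{-1}\preceq0$; (d) $(A_j+B_jF)^\top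 W^{-1}(A_j+B_jF)-W^{-1}\preceq0$. Problem $\mathcal{MPC}$: given the current state $x_{k|k}\in\mathbb X$ and horizon $N\ge1$, minimize, over policies $\pi_{k+h|k}:\mathbb X\to\mathbb U$, $h=0,\dots,N-1$, the cost $\rho_{k,k+N}\big(C(x_{k|k},\pi_{k|k}(x_{k|k})),\dots,C(x_{k+N-1|k},\pi_{k+N-1|k}(x_{k+N-1|k})),\,x_{k+N|k}^\top P x_{k+N|k}\big)$ subject to $x_{k+h+1|k}=A(w_{k+h})x_{k+h|k}+B(w_{k+h})\pi_{k+h|k}(x_{k+h|k})$, $\pi_{k+h|k}(x_{k+h|k})\in\mathbb U$, $x_{k+h+1|k}\in\mathbb X$ for $h\in\{0,\dots,N-1\}$, and $x_{k+N|k}\in\mathcal E_{\max}(W)$, all holding surely (for every disturbance realization). A minimizing policy is denoted $\{\pi^\ast_{k|k},\dots,\pi^\ast_{k+N-1|k}\}$, and the (time-invariant) model predictive control law is $\pi^{MPC}(x_k)=\pi^\ast_{k|k}(x_{k|k})$ with $x_{k|k}=x_k$. *)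

(* Defs.v *)
From HB Require Import structures.
From mathcomp Require Import all_boot all_order all_algebra.
From mathcomp Require Import all_classical all_reals all_analysis.

Set Implicit Arguments.
Unset Strict Implicit.
Unset Printing Implicit Defensive.

Import Order.TTheory GRing.Theory Num.Theory.
Import numFieldNormedType.Exports.

Local Open Scope classical_set_scope.
Local Open Scope ring_scope.

(* The norm that MathComp-Analysis puts on matrices is the sup norm, hence a
   separate Euclidean norm. *)
Definition norm2 (R : realType) (n : nat) (v : 'cV[R]_n) : R :=
  Num.sqrt (\sum_(i < n) v i 0 ^+ 2).

Definition quad (R : realType) (n : nat) (M : 'M[R]_n) (x : 'cV[R]_n) : R :=
  (x^T *m M *m x) 0 0.

Definition posdef (R : realType) (n : nat) (M : 'M[R]_n) : Prop :=
  M^T = M /\ forall x, x != 0 -> 0 < quad M x.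

Definition negdef (R : realType) (n : nat) (M : 'M[R]_n) : Prop :=
  M^T = M /\ forall x, x != 0 -> quad M x < 0.

Definition negsemidef (R : realType) (n : nat) (M : 'M[R]_n) : Prop :=
  M^T = M /\ forall x, quad M x <= 0.

(* The constraint sets X and U: {x : |T x|_2 <= r}. *)
Definition norm_set (R : realType) (n m : nat) (T : 'M[R]_(m, n)) (r : R) :
  set 'cV[R]_n := [set x | norm2 (T *m x) <= r].

(* E_max(W) *)
Definition ellipsoid (R : realType) (n : nat) (W : 'M[R]_n) : set 'cV[R]_n :=
  [set x | quad (invmx W) x <= 1].

Definition simplex (R : realType) (L : nat) : set 'cV[R]_L :=
  [set q | (forall j, 0 <= q j 0) /\ \sum_(j < L) q j 0 = 1].

Definition pmf_polytope (R : realType) (L nI nE : nat)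
    (SI : 'M[R]_(nI, L)) (TI : 'cV[R]_nI) (SE : 'M[R]_(nE, L)) (TE : 'cV[R]_nE) :
  set 'cV[R]_L :=
  [set q | [/\ simplex q, forall i, (SI *m q) i 0 <= TI i 0 & SE *m q = TE]].

(* The vertices (extreme points) of a convex set K. *)
Definition vertices (R : realType) (L : nat) (K : set 'cV[R]_L) :
  set 'cV[R]_L :=
  [set q | K q /\ forall q1 q2 (t : R), K q1 -> K q2 -> 0 < t < 1 ->
     q = t *: q1 + (1 - t) *: q2 -> q1 = q /\ q2 = q].

(* A disturbance w^[j] is represented by its index j : 'I_L.  For finitely
   valued variables, the product rule over initial segments of times, for all
   value vectors v, is equivalent to mutual independence. *)
Record iid_disturbance (R : realType) (d : measure_display)
    (Omega : measurableType d) (Pr : probability Omega R) (L : nat)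
    (p : 'cV[R]_L) (w : nat -> Omega -> 'I_L) : Prop := IidDisturbance {
  disturbance_measurable :
    forall k j, measurable [set om | w k om = j];
  disturbance_pmf :
    forall k j, Pr [set om | w k om = j] = (p j 0)%:E;
  disturbance_indep :
    forall (n : nat) (v : nat -> 'I_L),
      Pr [set om | forall k, (k < n)%N -> w k om = v k] =
      (\prod_(k < n) p (v k) 0)%:E }.

Definition is_trajectory (R : realType) (Nx Nu L : nat) (Omega : Type)
    (A : 'I_L -> 'M[R]_Nx) (B : 'I_L -> 'M[R]_(Nx, Nu))
    (w : nat -> Omega -> 'I_L) (x0 : 'cV[R]_Nx)
    (x : nat -> Omega -> 'cV[R]_Nx) (u : nat -> Omega -> 'cV[R]_Nu) : Prop :=
  (forall om, x 0%N om = x0) /\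
  (forall k om, x k.+1 om = A (w k om) *m x k om + B (w k om) *m u k om).

(* rho_k, for a random variable Z that is a function of (w_0, ..., w_k), i.e.
   of a (k+1)-tuple; the result is a function of (w_0, ..., w_(k-1)).  The
   supremum is a maximum whenever K is a nonempty polytope of pmfs. *)
Definition risk (R : realType) (L : nat) (K : set 'cV[R]_L) (k : nat)
    (Z : k.+1.-tuple 'I_L -> R) : k.-tuple 'I_L -> R :=
  fun h => sup [set \sum_(j < L) q j 0 * Z [tuple of rcons h j] | q in K].

(* rho_(k, k+n)(Z_k, ..., Z_(k+n)), each Z_i being a function of
   (w_0, ..., w_(i-1)). *)
Fixpoint dyn_risk (R : realType) (L : nat) (K : set 'cV[R]_L) (n k : nat)
    (Z : forall i, i.-tuple 'I_L -> R) {struct n} : k.-tuple 'I_L -> R :=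
  if n is n'.+1 then
    fun h => Z k h + risk K (dyn_risk K n' (k := k.+1) Z) h
  else Z k.

Definition stage_cost (R : realType) (Nx Nu : nat) (Q : 'M[R]_Nx)
    (Rm : 'M[R]_Nu) (x : 'cV[R]_Nx) (u : 'cV[R]_Nu) : R :=
  quad Q x + quad Rm u.

Record PE_feasible (R : realType) (Nx Nu L mx mu : nat)
    (A : 'I_L -> 'M[R]_Nx) (B : 'I_L -> 'M[R]_(Nx, Nu)) (K : set 'cV[R]_L)
    (Q : 'M[R]_Nx) (Rm : 'M[R]_Nu)
    (Tx : 'M[R]_(mx, Nx)) (xmax : R) (Tu : 'M[R]_(mu, Nu)) (umax : R)
    (W P : 'M[R]_Nx) (F : 'M[R]_(Nu, Nx)) : Prop := PEFeasible {
  PE_W : posdef W;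
  PE_P : posdef P;
  PE_input :
    negsemidef (F^T *m ((umax ^+ 2)^-1 *: (Tu^T *m Tu)) *m F - invmx W);
  PE_cost : forall q, vertices K q ->
    negdef (\sum_(j < L)
              q j 0 *: ((A j + B j *m F)^T *m P *m (A j + B j *m F))
            - P + (F^T *m Rm *m F + Q));
  PE_state : forall j : 'I_L,
    negsemidef ((A j + B j *m F)^T *m ((xmax ^+ 2)^-1 *: (Tx^T *m Tx))
                *m (A j + B j *m F) - invmx W);
  PE_invariant : forall j : 'I_L,
    negsemidef ((A j + B j *m F)^T *m invmx W *m (A j + B j *m F)
                - invmx W) }.

Definition PE_maximizer (R : realType) (Nx Nu L mx mu : nat)
    (A : 'I_L -> 'M[R]_Nx) (B : 'I_L -> 'M[R]_(Nx, Nu)) (K : set 'cV[R]_L)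
    (Q : 'M[R]_Nx) (Rm : 'M[R]_Nu)
    (Tx : 'M[R]_(mx, Nx)) (xmax : R) (Tu : 'M[R]_(mu, Nu)) (umax : R)
    (W P : 'M[R]_Nx) (F : 'M[R]_(Nu, Nx)) : Prop :=
  PE_feasible A B K Q Rm Tx xmax Tu umax W P F /\
  forall W' P' F', PE_feasible A B K Q Rm Tx xmax Tu umax W' P' F' ->
    ln (\det W') <= ln (\det W).

(* x_(k+i|k) as a function of (w_k, ..., w_(k+i-1)), from x_(k|k) = x under the
   policy h |-> pol h = pi_(k+h|k).  The system is time-invariant, so times are
   counted from k.  Policies are total functions, used only on X and for h < N. *)
Fixpoint pred_state (R : realType) (Nx Nu L : nat)
    (A : 'I_L -> 'M[R]_Nx) (B : 'I_L -> 'M[R]_(Nx, Nu))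
    (pol : nat -> 'cV[R]_Nx -> 'cV[R]_Nu) (x : 'cV[R]_Nx) (i : nat) :
  i.-tuple 'I_L -> 'cV[R]_Nx :=
  if i is h.+1 then fun t =>
    let y := pred_state A B pol x
               [tuple tnth t (widen_ord (leqnSn h) l) | l < h] in
    let j := tnth t ord_max in
    A j *m y + B j *m pol h y
  else fun=> x.

Lemma pred_state_rcons (R : realType) (Nx Nu L : nat)
    (A : 'I_L -> 'M[R]_Nx) (B : 'I_L -> 'M[R]_(Nx, Nu))
    (pol : nat -> 'cV[R]_Nx -> 'cV[R]_Nu) (x : 'cV[R]_Nx) (h : nat)
    (t : h.-tuple 'I_L) (j : 'I_L) :
  pred_state A B pol x [tuple of rcons t j] =
  A j *m pred_state A B pol x t + B j *m pol h (pred_state A B pol x t).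
Proof.
have e1 : tnth [tuple of rcons t j] ord_max = j.
  by rewrite (tnth_nth j) /= nth_rcons size_tuple ltnn eqxx.
have e2 : [tuple tnth [tuple of rcons t j] (widen_ord (leqnSn h) l) | l < h] = t.
  apply: eq_from_tnth => l; rewrite tnth_mktuple !(tnth_nth j) /= nth_rcons size_tuple.
  by rewrite ltn_ord.
by rewrite /= e1 e2.
Qed.

Record MPC_feasible (R : realType) (Nx Nu L : nat)
    (A : 'I_L -> 'M[R]_Nx) (B : 'I_L -> 'M[R]_(Nx, Nu))
    (X : set 'cV[R]_Nx) (U : set 'cV[R]_Nu) (W : 'M[R]_Nx) (N : nat)
    (x : 'cV[R]_Nx) (pol : nat -> 'cV[R]_Nx -> 'cV[R]_Nu) : Prop :=
  MPCFeasible {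
  MPC_policy : forall h, (h < N)%N -> forall y, X y -> U (pol h y);
  MPC_input : forall h, (h < N)%N -> forall t : h.-tuple 'I_L,
    U (pol h (pred_state A B pol x t));
  MPC_state : forall h, (h < N)%N -> forall t : h.+1.-tuple 'I_L,
    X (pred_state A B pol x t);
  MPC_terminal : forall t : N.-tuple 'I_L,
    ellipsoid W (pred_state A B pol x t) }.

(* rho_(k, k+N) of the predicted stage costs and of the terminal cost.  The
   history of length 0 is the empty list of disturbances since time k. *)
Definition MPC_cost (R : realType) (Nx Nu L : nat)
    (A : 'I_L -> 'M[R]_Nx) (B : 'I_L -> 'M[R]_(Nx, Nu)) (K : set 'cV[R]_L)
    (Q : 'M[R]_Nx) (Rm : 'M[R]_Nu) (P : 'M[R]_Nx) (N : nat)
    (x : 'cV[R]_Nx) (pol : nat -> 'cV[R]_Nx -> 'cV[R]_Nu) : R :=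
  @dyn_risk R L K N 0%N
    (fun i t => let y := pred_state A B pol x t in
       if (i < N)%N then stage_cost Q Rm y (pol i y) else quad P y)
    [tuple].

Definition MPC_minimizer (R : realType) (Nx Nu L : nat)
    (A : 'I_L -> 'M[R]_Nx) (B : 'I_L -> 'M[R]_(Nx, Nu)) (K : set 'cV[R]_L)
    (X : set 'cV[R]_Nx) (U : set 'cV[R]_Nu) (Q : 'M[R]_Nx) (Rm : 'M[R]_Nu)
    (W P : 'M[R]_Nx) (N : nat)
    (x : 'cV[R]_Nx) (pol : nat -> 'cV[R]_Nx -> 'cV[R]_Nu) : Prop :=
  MPC_feasible A B X U W N x pol /\
  forall pol', MPC_feasible A B X U W N x pol' ->
    MPC_cost A B K Q Rm P N x pol <= MPC_cost A B K Q Rm P N x pol'.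

Definition MPC_domain (R : realType) (Nx Nu L : nat)
    (A : 'I_L -> 'M[R]_Nx) (B : 'I_L -> 'M[R]_(Nx, Nu))
    (X : set 'cV[R]_Nx) (U : set 'cV[R]_Nu) (W : 'M[R]_Nx) (N : nat) :
  set 'cV[R]_Nx :=
  [set x | X x /\ exists pol, MPC_feasible A B X U W N x pol].

(* Main.v *)
Require Import Defs.
From HB Require Import structures.
From mathcomp Require Import all_boot all_order all_algebra.
From mathcomp Require Import all_classical all_reals all_analysis.

Set Implicit Arguments.
Unset Strict Implicit.
Unset Printing Implicit Defensive.

Import Order.TTheory GRing.Theory Num.Theory.
Import numFieldNormedType.Exports.

Local Open Scope classical_set_scope.
Local Open Scope ring_scope.

(** The predicted plan outlives one step of the plant.  After the first
    disturbance [j] is observed, the tail of the old feasible policy keeps all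
    remaining constraints, because its trajectory from the new state is the old
    trajectory whose first disturbance is fixed to [j]
    ([pred_state_tail]).  That trajectory ends in the terminal set one step too
    early, so one more control is needed there, and the terminal set is built to
    provide it: on the ellipsoid [quad (invmx W) y <= 1], the linear feedback
    [F] of the offline problem is an admissible input (by its input constraint)
    whose successors satisfy the state constraint (by its state constraint) and
    lie in the same ellipsoid (by its invariance constraint).  Hence the tail
    followed by [F] is feasible ([MPC_domain_next]). *)

(** * Quadratic forms and norm constraints *)

Lemma quadB (R : realType) (n : nat) (M M' : 'M[R]_n) (x : 'cV[R]_n) :
  quad (M - M') x = quad M x - quad M' x.
Proof. by rewrite /quad mulmxBr mulmxBl !mxE. Qed.

Lemma quad_congr (R : realType) (m n : nat) (G : 'M[R]_(m, n)) (S : 'M[R]_m)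
    (x : 'cV[R]_n) :
  quad (G^T *m S *m G) x = quad S (G *m x).
Proof. by rewrite /quad trmx_mul !mulmxA. Qed.

Lemma quad_gram (R : realType) (m n : nat) (T : 'M[R]_(m, n)) (c : R)
    (x : 'cV[R]_n) :
  quad (c *: (T^T *m T)) x = c * \sum_(i < m) (T *m x) i 0 ^+ 2.
Proof.
rewrite /quad -scalemxAr -scalemxAl mxE; congr (_ * _).
rewrite !mulmxA -trmx_mul -mulmxA mxE.
by apply: eq_bigr => i _; rewrite mxE expr2.
Qed.

Lemma norm_set_quad (R : realType) (m n : nat) (T : 'M[R]_(m, n)) (r : R)
    (x : 'cV[R]_n) (r0 : 0 < r) :
  quad ((r ^+ 2)^-1 *: (T^T *m T)) x <= 1 -> norm_set T r x.
Proof.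
rewrite quad_gram mulrC ler_pdivrMr ?exprn_gt0// mul1r => le_r2.
by rewrite /norm_set /= /norm2 -(ger0_norm (ltW r0)) -sqrtr_sqr ler_wsqrtr.
Qed.

(** The matrix inequality compares two quadratic forms in [y], so the bound 1 on
    the second passes to the first.  The input, state and invariance constraints
    on [F] all have this form. *)
Lemma ellipsoid_image (R : realType) (m n : nat) (G : 'M[R]_(m, n))
    (S : 'M[R]_m) (W : 'M[R]_n) (y : 'cV[R]_n) :
  negsemidef (G^T *m S *m G - invmx W) -> ellipsoid W y ->
  quad S (G *m y) <= 1.
Proof.
move=> [_ /(_ y)]; rewrite quadB quad_congr subr_le0 => le_W W1.
exact: le_trans le_W W1.
Qed.

(** * Predicted trajectories *)

Section Prediction.

Variables (R : realType) (Nx Nu L : nat).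
Variables (A : 'I_L -> 'M[R]_Nx) (B : 'I_L -> 'M[R]_(Nx, Nu)).

Lemma tuple_rcons_ex (T : Type) (h : nat) (t : h.+1.-tuple T) :
  exists (s : h.-tuple T) (j : T), t = [tuple of rcons s j].
Proof.
case: t => t; elim/last_ind: t => [//|s j _] ts.
have sh : size s == h by move: (ts); rewrite size_rcons eqSS.
by exists (Tuple sh), j; apply: val_inj.
Qed.

Lemma eq_pred_state (pol pol' : nat -> 'cV[R]_Nx -> 'cV[R]_Nu) (x : 'cV[R]_Nx)
    (h : nat) (t : h.-tuple 'I_L) :
  (forall i, (i < h)%N -> pol i =1 pol' i) ->
  pred_state A B pol x t = pred_state A B pol' x t.
Proof.
elim: h t => [//|h IH] t eq_pol.
have [s [j ->]] := tuple_rcons_ex t.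
by rewrite !pred_state_rcons IH ?eq_pol// => i ih; apply: eq_pol; apply: ltnW.
Qed.

(** Dynamic programming consistency: the dynamics being time-invariant, the tail
    of a policy, started where the policy leads after disturbance [j], reproduces
    the original prediction along [j :: t]. *)
Lemma pred_state_tail (pol : nat -> 'cV[R]_Nx -> 'cV[R]_Nu) (x : 'cV[R]_Nx)
    (j : 'I_L) (h : nat) (t : h.-tuple 'I_L) :
  pred_state A B (fun i => pol i.+1) (A j *m x + B j *m pol 0%N x) t =
  pred_state A B pol x [tuple of j :: t].
Proof.
elim: h t => [|h IH] t.
  have -> : [tuple of j :: t] = [tuple of rcons [tuple] j].
    by apply: val_inj; rewrite /= [t]tuple0.
  by rewrite pred_state_rcons.
have [s [i ->]] := tuple_rcons_ex t.
have -> : [tuple of j :: [tuple of rcons s i]] =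
    [tuple of rcons [tuple of j :: s] i] by apply: val_inj.
by rewrite !pred_state_rcons IH.
Qed.

(** * Recursive feasibility *)

(** The predicted state enters [E] before the last control is used; elsewhere the
    last control still has to map [X] to [U]; the last control of the old policy does
    that. *)
Definition shifted_policy (E : set 'cV[R]_Nx) (kappa : 'cV[R]_Nx -> 'cV[R]_Nu)
    (n : nat) (pol : nat -> 'cV[R]_Nx -> 'cV[R]_Nu) :
    nat -> 'cV[R]_Nx -> 'cV[R]_Nu :=
  fun h y => if (h < n)%N then pol h.+1 y
             else if `[< E y >] then kappa y else pol n y.

Lemma pred_state_shifted (E : set 'cV[R]_Nx) (kappa : 'cV[R]_Nx -> 'cV[R]_Nu)
    (n : nat) (pol : nat -> 'cV[R]_Nx -> 'cV[R]_Nu) (x : 'cV[R]_Nx) (j : 'I_L)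
    (h : nat) (t : h.-tuple 'I_L) :
  (h <= n)%N ->
  pred_state A B (shifted_policy E kappa n pol) (A j *m x + B j *m pol 0%N x) t =
  pred_state A B pol x [tuple of j :: t].
Proof.
move=> hn; rewrite -pred_state_tail; apply: eq_pred_state => i ih y.
by rewrite /shifted_policy (leq_trans ih hn).
Qed.

(** The standard terminal-set argument: a feedback [kappa], not necessarily
    linear, that is admissible on the terminal set and keeps the state both in
    [X] and in the terminal set makes the feasible set invariant under the first
    control of any feasible policy. *)
Lemma MPC_domain_next (X : set 'cV[R]_Nx) (U : set 'cV[R]_Nu) (W : 'M[R]_Nx)
    (kappa : 'cV[R]_Nx -> 'cV[R]_Nu) (N : nat) (x : 'cV[R]_Nx)
    (pol : nat -> 'cV[R]_Nx -> 'cV[R]_Nu) (j : 'I_L) :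
  (0 < N)%N ->
  (forall y, ellipsoid W y -> U (kappa y)) ->
  (forall i y, ellipsoid W y -> X (A i *m y + B i *m kappa y)) ->
  (forall i y, ellipsoid W y -> ellipsoid W (A i *m y + B i *m kappa y)) ->
  MPC_feasible A B X U W N x pol ->
  MPC_domain A B X U W N (A j *m x + B j *m pol 0%N x).
Proof.
case: N => [//|n] _ kappaU kappaX kappaE [polU inU inX term].
pose pol' := shifted_policy (ellipsoid W) kappa n pol.
set x' := A j *m x + B j *m pol 0%N x.
have shiftE h (t : h.-tuple 'I_L) : (h <= n)%N ->
    pred_state A B pol' x' t = pred_state A B pol x [tuple of j :: t].
  exact: pred_state_shifted.
have pre_terminal (t : n.-tuple 'I_L) : ellipsoid W (pred_state A B pol' x' t).
  by rewrite shiftE.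
have pol'n y : ellipsoid W y -> pol' n y = kappa y.
  by move=> Ey; rewrite /pol' /shifted_policy ltnn asboolT.
have h_cases h : (h < n.+1)%N -> (h < n)%N \/ h = n.
  by rewrite ltnS leq_eqVlt => /orP[/eqP|]; [right|left].
split; first by rewrite -[x']/(pred_state A B pol' x' [tuple]) shiftE//; exact: inX.
exists pol'; split.
- move=> h /h_cases[hn|->] y Xy; rewrite /pol' /shifted_policy.
    by rewrite hn; apply: polU.
  by rewrite ltnn; case: asboolP => [/kappaU//|_]; apply: polU.
- move=> h /h_cases[hn|hn] t.
    have -> : pol' h = pol h.+1.
      by apply/funext => y; rewrite /pol' /shifted_policy hn.
    by rewrite (shiftE _ _ (ltnW hn)); apply: inU.
  by subst h; rewrite pol'n//; apply: kappaU.
- move=> h /h_cases[hn|hn] t; first by rewrite (shiftE _ _ hn); apply: inX.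
  subst h; have [s [i ->]] := tuple_rcons_ex t.
  by rewrite pred_state_rcons pol'n//; apply: kappaX.
- move=> t; have [s [i ->]] := tuple_rcons_ex t.
  by rewrite pred_state_rcons pol'n//; apply: kappaE.
Qed.

End Prediction.

Theorem theorem7p3 (R : realType) (Nx Nu L mx mu nI nE : nat)
  (A : 'I_L -> 'M[R]_Nx) (B : 'I_L -> 'M[R]_(Nx, Nu))
  (p : 'cV[R]_L) (hp : simplex p) (hp0 : forall j, 0 < p j 0)
  (d : measure_display) (Omega : measurableType d) (Pr : probability Omega R)
  (w : nat -> Omega -> 'I_L) (hw : iid_disturbance Pr p w)
  (SI : 'M[R]_(nI, L)) (TI : 'cV[R]_nI) (SE : 'M[R]_(nE, L)) (TE : 'cV[R]_nE)
  (hK : pmf_polytope SI TI SE TE !=set0)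
  (Q : 'M[R]_Nx) (Rm : 'M[R]_Nu) (hQ : posdef Q) (hR : posdef Rm)
  (Tx : 'M[R]_(mx, Nx)) (xmax : R) (hxmax : 0 < xmax)
  (Tu : 'M[R]_(mu, Nu)) (umax : R) (humax : 0 < umax)
  (hXc : compact (norm_set Tx xmax)) (hXv : convex_set (norm_set Tx xmax))
  (hUc : compact (norm_set Tu umax)) (hUv : convex_set (norm_set Tu umax))
  (hPE : exists W P F, PE_feasible A B (pmf_polytope SI TI SE TE) Q Rm
                         Tx xmax Tu umax W P F)
  (W P : 'M[R]_Nx)
  (hWP : exists F, PE_maximizer A B (pmf_polytope SI TI SE TE) Q Rm
                     Tx xmax Tu umax W P F)
  (N : nat) (hN : (1 <= N)%N)
  (x0 : 'cV[R]_Nx) (x : nat -> Omega -> 'cV[R]_Nx)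
  (u : nat -> Omega -> 'cV[R]_Nu) (hx : is_trajectory A B w x0 x u)
  (k : nat) (om : Omega)
  (hxk : MPC_domain A B (norm_set Tx xmax) (norm_set Tu umax) W N (x k om))
  (pol : nat -> 'cV[R]_Nx -> 'cV[R]_Nu)
  (hpol : MPC_minimizer A B (pmf_polytope SI TI SE TE) (norm_set Tx xmax)
            (norm_set Tu umax) Q Rm W P N (x k om) pol)
  (huk : u k om = pol 0%N (x k om)) :
  forall j : 'I_L,
    MPC_domain A B (norm_set Tx xmax) (norm_set Tu umax) W N
      (A j *m x k om + B j *m u k om).
Proof.
move=> j; have [F [[_ _ Fin _ Fstate Finv] _]] := hWP.
have closedE i y : A i *m y + B i *m (F *m y) = (A i + B i *m F) *m y.
  by rewrite mulmxDl mulmxA.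
rewrite huk; apply: (MPC_domain_next (kappa := mulmx F)) hpol.1 => //.
- by move=> y Ey; apply: norm_set_quad => //; apply: ellipsoid_image Ey.
- move=> i y Ey; rewrite closedE; apply: norm_set_quad => //.
  exact: ellipsoid_image Ey.
- by move=> i y Ey; rewrite closedE; apply: ellipsoid_image Ey.
Qed.
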